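(* Let $1\to H\to G\xrightarrow{\pi}Q\to1$ be a short exact sequence of groups and suppose that there is an upper bound $d$ on $\underline{cd}(\pi^{-1}(F))$ where $F$ ranges over all finite subgroups of $Q$. Then $$\underline{cd}(G)\le d+\underline{cd}(Q).$$
   Context: For a group $G$, $\underline{cd}(G)$ is the Bredon cohomological dimension of $G$ with respect to the family $\mathfrak F$ of finite subgroups of $G$: let $\mathcal O_{\mathfrak F}G$ be the orbit category with objects $G/H$ ($H\le G$ finite) and morphisms the $G$-maps; right $\mathcal O_{\mathfrak F}G$-modules are contravariant functors from $\mathcal O_{\mathfrak F}G$ to abelian groups, with exactness objectwise; then $\underline{cd}(G)$ is the projective dimension of the constant module $\underline{\mathbb Z}$ (possibly $\infty$). *)

(* Defs.v *)
From HB Require Import structures.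
From mathcomp Require Import all_boot all_order all_algebra.
From mathcomp Require Import boolp classical_sets cardinality.
From mathcomp Require Import constructive_ereal.

Set Implicit Arguments.
Unset Strict Implicit.
Unset Printing Implicit Defensive.

Local Open Scope group_scope.
Local Open Scope quotient_scope.
Local Open Scope classical_set_scope.

(* Groups are arbitrary, possibly infinite [groupType]s; group morphisms are
   [UMagmaMorphism.type]; a subgroup of G is an element of [groupClosed G],
   i.e. a boolean predicate (classically, any subset) closed under the group
   operations. *)

Definition finite_subg (G : groupType) (S : groupClosed G) : Prop :=
  finite_set [set x : G | x \in S].

Section Subg.
Variables (G : groupType) (S : groupClosed G).

Record subg := Subg { subg_val :> G; subg_valP : subg_val \in S }.

HB.instance Definition _ := [isSub for subg_val].
HB.instance Definition _ := [Choice of subg by <:].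

Lemma subg_group_closed : group_closed (S : {pred G}).
Proof. by split; [exact: gpred1 | exact: gpredF]. Qed.

HB.instance Definition _ :=
  SubChoice_isSubGroup.Build G (S : {pred G}) subg subg_group_closed.

End Subg.

Section Preimage.
Variables (G Q : groupType) (pi : UMagmaMorphism.type G Q) (F : groupClosed Q).

Definition preim_subg : {pred G} := fun g => pi g \in F.

Lemma preim_subgM : mulg_closed preim_subg.
Proof.
by move=> x y Fx Fy; rewrite unfold_in gmulfM; exact: (gpredM (s := F)).
Qed.

Lemma preim_subg1 : 1 \in preim_subg.
Proof. by rewrite unfold_in gmulf1 gpred1. Qed.

Lemma preim_subgV : invg_closed preim_subg.
Proof. by move=> x Fx; rewrite unfold_in gmulfV gpredV. Qed.

HB.instance Definition _ := isMulClosed.Build G preim_subg preim_subgM.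
HB.instance Definition _ := isMul1Closed.Build G preim_subg preim_subg1.
HB.instance Definition _ := isInvClosed.Build G preim_subg preim_subgV.

End Preimage.

Section Coset.
Variables (G : groupType) (S : groupClosed G).

Definition lcoset_rel : rel G := fun x y => x^-1 * y \in S.

Lemma lcoset_rel_refl : reflexive lcoset_rel.
Proof. by move=> x; rewrite /lcoset_rel mulVg gpred1. Qed.

Lemma lcoset_rel_sym : symmetric lcoset_rel.
Proof. by move=> x y; rewrite /lcoset_rel -gpredV invgM invgK. Qed.

Lemma lcoset_rel_trans : transitive lcoset_rel.
Proof.
move=> y x z Sxy Syz; rewrite /lcoset_rel.
by have := gpredM _ _ Sxy Syz; rewrite mulgA mulgK.
Qed.

Canonical lcoset_equiv :=
  EquivRel lcoset_rel lcoset_rel_refl lcoset_rel_sym lcoset_rel_trans.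

(* the set G/S of left cosets gS *)
Definition coset := {eq_quot lcoset_rel}.

HB.instance Definition _ := Choice.on coset.
HB.instance Definition _ := EqQuotient.on coset.

Definition coset_act (g : G) (u : coset) : coset := \pi_coset (g * repr u).

Lemma coset_act_pi (g x : G) : coset_act g (\pi_coset x) = \pi_coset (g * x).
Proof.
apply/eqquotP; rewrite /= /lcoset_rel invgM -mulgA mulKg.
by have /eqquotP := reprK (\pi_coset x).
Qed.

End Coset.

(* The orbit category of G for the family of finite subgroups: the object
   [Orbit finS] stands for the G-set G/S. *)
Record orbit (G : groupType) := Orbit {
  orbit_stab : groupClosed G;
  orbit_finite : finite_subg orbit_stab
}.

Definition orbit_set (G : groupType) (X : orbit G) := coset (orbit_stab X).

Record orbit_hom (G : groupType) (X Y : orbit G) := OrbitHom {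
  orbit_fun :> orbit_set X -> orbit_set Y;
  orbit_funJ : forall (g : G) (u : orbit_set X),
    orbit_fun (coset_act g u) = coset_act g (orbit_fun u)
}.

Definition orbit_id (G : groupType) (X : orbit G) : orbit_hom X X :=
  @OrbitHom G X X id (fun _ _ => erefl).

Lemma orbit_comp_subproof (G : groupType) (X Y Z : orbit G)
    (f : orbit_hom Y Z) (h : orbit_hom X Y) (g : G) (u : orbit_set X) :
  (f \o h) (coset_act g u) = coset_act g ((f \o h) u).
Proof. by rewrite /= !orbit_funJ. Qed.

Definition orbit_comp (G : groupType) (X Y Z : orbit G)
    (f : orbit_hom Y Z) (h : orbit_hom X Y) : orbit_hom X Z :=
  OrbitHom (orbit_comp_subproof f h).

(* right modules over the orbit category *)
Record orbit_mod (G : groupType) := OrbitMod {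
  mod_obj :> orbit G -> zmodType;
  mod_map : forall X Y : orbit G,
    orbit_hom X Y -> {additive mod_obj Y -> mod_obj X};
  mod_map_id : forall (X : orbit G) (m : mod_obj X),
    mod_map (orbit_id X) m = m;
  mod_map_comp : forall (X Y Z : orbit G) (f : orbit_hom Y Z)
      (h : orbit_hom X Y) (m : mod_obj Z),
    mod_map (orbit_comp f h) m = mod_map h (mod_map f m)
}.

Arguments mod_map {G} M {X Y} f : rename.

Record mod_hom (G : groupType) (M N : orbit_mod G) := ModHom {
  mod_fun :> forall X : orbit G, {additive M X -> N X};
  mod_fun_nat : forall (X Y : orbit G) (f : orbit_hom X Y) (m : M Y),
    mod_fun X (mod_map M f m) = mod_map N f (mod_fun Y m)
}.

Definition mod_epi (G : groupType) (M N : orbit_mod G) (f : mod_hom M N) :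
  Prop := forall (X : orbit G) (n : N X), exists m : M X, f X m = n.

Definition mod_exact (G : groupType) (M N P : orbit_mod G)
    (f : mod_hom M N) (g : mod_hom N P) : Prop :=
  forall (X : orbit G) (n : N X), g X n = 0%R <-> exists m : M X, f X m = n.

Definition mod_zero (G : groupType) (M : orbit_mod G) : Prop :=
  forall (X : orbit G) (m : M X), m = 0%R.

Definition mod_projective (G : groupType) (P : orbit_mod G) : Prop :=
  forall (M N : orbit_mod G) (p : mod_hom M N) (f : mod_hom P N),
    mod_epi p ->
    exists h : mod_hom P M, forall (X : orbit G) (x : P X), p X (h X x) = f X x.

(* there is an exact sequence 0 -> P_n -> ... -> P_0 -> M -> 0 with every P_k
   projective, written as an unbounded one with P_k = 0 for k > n *)
Definition has_proj_resolution (G : groupType) (M : orbit_mod G) (n : nat) :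
    Prop :=
  exists (P : nat -> orbit_mod G) (d : forall k, mod_hom (P k.+1) (P k))
         (e : mod_hom (P 0) M),
    [/\ forall k, mod_projective (P k),
        forall k, (n < k)%N -> mod_zero (P k),
        mod_epi e,
        mod_exact (d 0) e
      & forall k, mod_exact (d k.+1) (d k)].

(* The least length of a projective resolution of M, +oo if there is none
   (so the zero module is given projective dimension 0). *)
Definition proj_dim (G : groupType) (M : orbit_mod G) : \bar int :=
  if pselect (exists n, `[< has_proj_resolution M n >]) is left e
  then (Posz (ex_minn e))%:E else +oo%E.

Definition const_Z (G : groupType) : orbit_mod G :=
  @OrbitMod G (fun=> int) (fun _ _ _ => idfun)
    (fun _ _ => erefl) (fun _ _ _ _ _ _ => erefl).

(* Bredon cohomological dimension for the family of finite subgroups *)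
Definition bredon_cd (G : groupType) : \bar int := proj_dim (const_Z G).

(* Main.v *)
Require Import Defs.
From HB Require Import structures.
From mathcomp Require Import all_boot all_order all_algebra.
From mathcomp Require Import boolp classical_sets cardinality.
From mathcomp Require Import constructive_ereal.

Set Implicit Arguments.
Unset Strict Implicit.
Unset Printing Implicit Defensive.

Import Defs GRing.Theory.

(** Write pd for projective dimension, and for a group morphism phi : A -> B let
[push phi] be the functor A/K |-> B/phi(K) of orbit categories; precomposition
with it ([mod_pull phi]) turns modules over B into modules over A and is exact.
It sends the constant module Z to Z.  So a projective resolution P_* of Z over
Q, of length n, becomes an exact sequence
0 -> pi^*P_n -> ... -> pi^*P_0 -> Z -> 0 over G, and it suffices that
pd (pi^*P) <= d for every projective P ([pd_le_pull_projective]): a module with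
a resolution of length n by modules of pd at most d has pd at most d + n
([pd_le_resolution]).

A projective P is a retract of a free module, that is, of a direct sum of
modules Z[-, Q/F], and pd does not increase under retracts
([pd_le_retract]).  For L = pi^-1(F), the module pi^*Z[-, Q/F] is
G/K |-> Z[(G/L)^K], which is the module induced from the constant module Z
over L.  Induction from L to G is exact and preserves projectives, since it is
left adjoint to the exact restriction functor ([ind_projective]); it therefore
turns a resolution of Z over L of length d into one of pi^*Z[-, Q/F].  The
direct sum over all the generators of the free module is handled by inducing
from the whole family of groups L at once.

The bound pd <= n is handled through the inductive predicate [pd_le]: a
horseshoe argument ([pd_le_ext]) gives closure under extensions, from which the
other properties follow without Ext groups. *)

(** * Additive maps and kernels *)

Lemma dep_choice (I : Type) (T : I -> Type) (R : forall i, T i -> Prop) :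
  (forall i, exists t, R i t) -> exists f : forall i, T i, forall i, R i (f i).
Proof.
move=> ex; exists (fun i => sval (cid (ex i))) => i; exact: svalP (cid (ex i)).
Qed.

Section AdditiveMaps.
Local Open Scope ring_scope.

Definition additive_of (A B : zmodType) (f : A -> B) (fB : zmod_morphism f) :
    {additive A -> B} :=
  HB.pack f (GRing.isZmodMorphism.Build A B f fB).

Variables (A B : zmodType) (f : {additive A -> B}).

Definition kernel_pred : {pred A} := fun a => f a == 0.

Lemma kernel_pred_zmod_closed : zmod_closed kernel_pred.
Proof.
split; first by rewrite unfold_in raddf0.
by move=> x y; rewrite !unfold_in raddfB => /eqP-> /eqP->; rewrite subr0.
Qed.

HB.instance Definition _ :=
  GRing.isZmodClosed.Build A kernel_pred kernel_pred_zmod_closed.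

(** The kernel of [f], as a subgroup type of [A]. *)
Record kernel := Kernel { kernel_val : A;
  kernel_valP : kernel_val \in kernel_pred }.

HB.instance Definition _ := [isSub for kernel_val].
HB.instance Definition _ := [Choice of kernel by <:].
HB.instance Definition _ := [SubChoice_isSubZmodule of kernel by <:].

Lemma kernelK (x : kernel) : f (val x) = 0.
Proof. exact/eqP/(valP x). Qed.

End AdditiveMaps.

(** An additive map whose image lies in that of an injective one factors
    through it. *)
Lemma lift_to_kernel (A B C : zmodType) (i : {additive A -> B}) (p : B -> C)
    (X : zmodType) (t : {additive X -> B}) :
  injective i -> (forall b, p b = 0%R -> exists a, i a = b) ->
  (forall x, p (t x) = 0%R) -> exists u : {additive X -> A}, forall x, i (u x) =
    t x.
Proof.
move=> i_inj i_p pt.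
have [u ut] := choice (fun x => i_p _ (pt x)).
have uB : zmod_morphism u by move=> x y; apply: i_inj;
  rewrite raddfB !ut raddfB.
by exists (additive_of uB).
Qed.

(** * Modules over the orbit category and projective dimension *)

Section Modules.
Local Open Scope ring_scope.
Variable G : groupType.
Implicit Types (M N P K A B C : orbit_mod G).

Definition mod_id M : mod_hom M M :=
  @ModHom G M M (fun=> idfun) (fun _ _ _ _ => erefl).

Lemma mod_comp_nat M N P (g : mod_hom N P) (f : mod_hom M N) X Y
    (h : orbit_hom X Y) (m : M Y) :
  (g X \o f X) (mod_map M h m) = mod_map P h ((g Y \o f Y) m).
Proof. by rewrite /= !mod_fun_nat. Qed.

Definition mod_comp M N P (g : mod_hom N P) (f : mod_hom M N) : mod_hom M P :=
  @ModHom G M P (fun X => g X \o f X) (mod_comp_nat g f).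

Lemma mod_add_nat M N (f g : mod_hom M N) X Y (h : orbit_hom X Y) (m : M Y) :
  (f X \+ g X) (mod_map M h m) = mod_map N h ((f Y \+ g Y) m).
Proof. by rewrite /= !mod_fun_nat raddfD. Qed.

Definition mod_add M N (f g : mod_hom M N) : mod_hom M N :=
  @ModHom G M N (fun X => f X \+ g X) (mod_add_nat f g).

Lemma mod_sub_nat M N (f g : mod_hom M N) X Y (h : orbit_hom X Y) (m : M Y) :
  (f X \- g X) (mod_map M h m) = mod_map N h ((f Y \- g Y) m).
Proof. by rewrite /= !mod_fun_nat raddfB. Qed.

Definition mod_sub M N (f g : mod_hom M N) : mod_hom M N :=
  @ModHom G M N (fun X => f X \- g X) (mod_sub_nat f g).

(** Objectwise injectivity. *)
Definition mod_inj M N (f : mod_hom M N) := forall X, injective (f X).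

Lemma mod_injP M N (f : mod_hom M N) :
  (forall X m, f X m = 0 -> m = 0) -> mod_inj f.
Proof.
by move=> f0 X x y /eqP; rewrite -subr_eq0 -raddfB => /eqP/f0/eqP;
  rewrite subr_eq0 => /eqP.
Qed.

Section Ker.
Variables (M N : orbit_mod G) (f : mod_hom M N).

Lemma mod_ker_mapP X Y (h : orbit_hom X Y) (x : kernel (f Y)) :
  mod_map M h (val x) \in kernel_pred (f X).
Proof. by rewrite unfold_in mod_fun_nat kernelK raddf0. Qed.

Lemma mod_ker_map_morphism X Y (h : orbit_hom X Y) :
  zmod_morphism (fun x => Kernel (mod_ker_mapP h x)).
Proof. by move=> x y; apply: val_inj; rewrite /= raddfB. Qed.

Lemma mod_ker_id X (x : kernel (f X)) :
  additive_of (mod_ker_map_morphism (orbit_id X)) x = x.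
Proof. by apply: val_inj; rewrite /= mod_map_id. Qed.

Lemma mod_ker_comp X Y Z (g : orbit_hom Y Z) (h : orbit_hom X Y)
    (x : kernel (f Z)) :
  additive_of (mod_ker_map_morphism (orbit_comp g h)) x =
  additive_of (mod_ker_map_morphism h) (additive_of (mod_ker_map_morphism g) x).
Proof. by apply: val_inj; rewrite /= mod_map_comp. Qed.

(** The kernel of a map of modules, computed objectwise. *)
Definition mod_ker : orbit_mod G :=
  @OrbitMod G (fun X => kernel (f X)) _ mod_ker_id mod_ker_comp.

Lemma ker_inc_morphism X : zmod_morphism (@kernel_val _ _ (f X)).
Proof. by []. Qed.

Definition ker_inc : mod_hom mod_ker M :=
  @ModHom G mod_ker M (fun X => additive_of (@ker_inc_morphism X))
    (fun _ _ _ _ => erefl).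

Lemma ker_inc_inj : mod_inj ker_inc.
Proof. by move=> X; exact: val_inj. Qed.

Lemma ker_inc_exact : mod_exact ker_inc f.
Proof.
move=> X n; split=> [fn0|[m <-]]; last exact: kernelK.
have fn0' : n \in kernel_pred (f X) by apply/eqP.
by exists (Kernel fn0').
Qed.

End Ker.

Section Sum.
Variables M N : orbit_mod G.

Lemma mod_sum_map_morphism X Y (h : orbit_hom X Y) :
  zmod_morphism (fun x : M Y * N Y => (mod_map M h x.1, mod_map N h x.2)).
Proof. by move=> x y; rewrite /= !raddfB. Qed.

Lemma mod_sum_id X (x : M X * N X) :
  additive_of (mod_sum_map_morphism (orbit_id X)) x = x.
Proof. by case: x => x y; rewrite /= !mod_map_id. Qed.

Lemma mod_sum_comp X Y Z (g : orbit_hom Y Z) (h : orbit_hom X Y)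
    (x : M Z * N Z) :
  additive_of (mod_sum_map_morphism (orbit_comp g h)) x =
  additive_of (mod_sum_map_morphism h) (additive_of (mod_sum_map_morphism g) x).
Proof. by rewrite /= !mod_map_comp. Qed.

(** The direct sum of two modules. *)
Definition mod_sum : orbit_mod G :=
  @OrbitMod G (fun X => (M X * N X)%type) _ mod_sum_id mod_sum_comp.

Lemma sum_in1_morphism X : zmod_morphism (fun m : M X => (m, 0 : N X)).
Proof. by move=> x y; congr pair; rewrite subr0. Qed.
Lemma sum_in2_morphism X : zmod_morphism (fun n : N X => (0 : M X, n)).
Proof. by move=> x y; congr pair; rewrite subr0. Qed.

Lemma sum_in1_nat X Y (h : orbit_hom X Y) (m : M Y) :
  additive_of (@sum_in1_morphism X) (mod_map M h m) =
  mod_map mod_sum h (additive_of (@sum_in1_morphism Y) m).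
Proof. by rewrite /= raddf0. Qed.
Lemma sum_in2_nat X Y (h : orbit_hom X Y) (m : N Y) :
  additive_of (@sum_in2_morphism X) (mod_map N h m) =
  mod_map mod_sum h (additive_of (@sum_in2_morphism Y) m).
Proof. by rewrite /= raddf0. Qed.

Definition sum_in1 : mod_hom M mod_sum := @ModHom G M mod_sum _ sum_in1_nat.
Definition sum_in2 : mod_hom N mod_sum := @ModHom G N mod_sum _ sum_in2_nat.

Definition sum_pr1 : mod_hom mod_sum M :=
  @ModHom G mod_sum M (fun X => fst) (fun _ _ _ _ => erefl).
Definition sum_pr2 : mod_hom mod_sum N :=
  @ModHom G mod_sum N (fun X => snd) (fun _ _ _ _ => erefl).

End Sum.

(** The universal property of the kernel [i] of [p]. *)
Lemma mod_lift A B C (i : mod_hom A B) (p : mod_hom B C) X (t : mod_hom X B) :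
  mod_inj i -> mod_exact i p -> (forall O x, p O (t O x) = 0) ->
  exists u : mod_hom X A, forall O x, i O (u O x) = t O x.
Proof.
move=> i_inj ip pt.
have /dep_choice[u ut] O :=
  lift_to_kernel (i_inj O) (fun b => (ip O b).1) (pt O).
have u_nat O O' (h : orbit_hom O O') (x : X O') :
    u O (mod_map X h x) = mod_map A h (u O' x).
  by apply: (i_inj O); rewrite mod_fun_nat !ut mod_fun_nat.
by exists (ModHom u_nat).
Qed.

(** [M] is a retract, that is a direct summand up to isomorphism, of [N]. *)
Definition mod_retract M N := exists (i : mod_hom M N) (r : mod_hom N M),
  forall X m, r X (i X m) = m.

Lemma retract_projective M N :
  mod_retract M N -> mod_projective N -> mod_projective M.
Proof.
move=> [i [r ri]] N_proj A B p f p_epi.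
have [h hP] := N_proj _ _ p (mod_comp f r) p_epi.
by exists (mod_comp h i) => X x; rewrite /= hP /= ri.
Qed.

Lemma sum_projective M N :
  mod_projective M -> mod_projective N -> mod_projective (mod_sum M N).
Proof.
move=> M_proj N_proj A B p f p_epi.
have [u uP] := M_proj _ _ p (mod_comp f (sum_in1 M N)) p_epi.
have [v vP] := N_proj _ _ p (mod_comp f (sum_in2 M N)) p_epi.
exists (mod_add (mod_comp u (sum_pr1 M N)) (mod_comp v (sum_pr2 M N))) =>
  X [x y].
rewrite /= raddfD uP vP /= -raddfD; congr (f X _).
by congr pair; rewrite /= ?addr0 ?add0r.
Qed.

Lemma zero_projective M : mod_zero M -> mod_projective M.
Proof.
move=> M0 A B p f p_epi.
have nat0 X Y (h : orbit_hom X Y) (m : M Y) :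
  (\0 : {additive M X -> A X}) (mod_map M h m) =
   mod_map A h ((\0 : {additive M Y -> A Y}) m) by rewrite /= raddf0.
exists (@ModHom G M A _ nat0) => X x.
by rewrite (M0 X x) !raddf0.
Qed.

(** [pd_le n M]: the module [M] has projective dimension at most [n]. It is
    projective when [n = 0]; otherwise some projective module surjects onto it
    with a kernel of projective dimension at most [n - 1]. *)
Fixpoint pd_le (n : nat) (M : orbit_mod G) : Prop :=
  if n is k.+1 then
    exists (K P : orbit_mod G) (i : mod_hom K P) (p : mod_hom P M),
      [/\ mod_projective P, mod_inj i, mod_exact i p, mod_epi p & pd_le k K]
  else mod_projective M.

Lemma pd_leS n M : pd_le n M -> pd_le n.+1 M.
Proof.
elim: n M => [|n IH] M.
  move=> M_proj; exists (mod_ker (mod_id M)), M, (ker_inc _), (mod_id M);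
    split=> //.
  - exact: ker_inc_inj.
  - exact: ker_inc_exact.
  - by move=> X m; exists m.
  by apply: zero_projective => X m; apply: val_inj;
    exact: (@kernelK _ _ (mod_id M X) m).
move=> [K [P [i [p [P_proj i_inj ip p_epi /IH K_n]]]]].
by exists K, P, i, p.
Qed.

Lemma pd_le_mono m n M : (m <= n)%N -> pd_le m M -> pd_le n M.
Proof. by move=> /subnK<- Mm; elim: (n - m)%N => // k /pd_leS. Qed.

(** Horseshoe lemma: projective dimension at most [n] passes to extensions. *)
Lemma pd_le_ext n A B C (f : mod_hom A B) (g : mod_hom B C) :
  mod_inj f -> mod_exact f g -> mod_epi g ->
  pd_le n A -> pd_le n C -> pd_le n B.
Proof.
elim: n A B C f g => [|n IH] A B C f g f_inj fg g_epi.
  move=> A_proj C_proj.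
  have [s sP] := C_proj _ _ g (mod_id C) g_epi.
  have [|t tP] := mod_lift (t := mod_sub (mod_id B) (mod_comp s g)) f_inj fg.
    by move=> X x; rewrite /= raddfB sP /= subrr.
  apply: retract_projective (sum_projective A_proj C_proj).
  exists (mod_add (mod_comp (sum_in1 A C) t) (mod_comp (sum_in2 A C) g)).
  exists (mod_add (mod_comp f (sum_pr1 A C)) (mod_comp s (sum_pr2 A C))) => X b.
  by rewrite /= addr0 add0r tP /= subrK.
move=> [KA [PA [iA [pA [PA_proj iA_inj iAp pA_epi KA_n]]]]].
move=> [KC [PC [iC [pC [PC_proj iC_inj iCp pC_epi KC_n]]]]].
have [s sP] := PC_proj _ _ g pC g_epi.
(* [s] lifts [pC] to [B], so [PA + PC] surjects onto [B]; its kernel [ker p] is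
   an extension of [KC] by [KA], which the maps [u] and [v] below exhibit. *)
pose p := mod_add (mod_comp f (mod_comp pA (sum_pr1 PA PC)))
  (mod_comp s (sum_pr2 PA PC)).
have gp X x : g X (p X x) = pC X x.2.
  by rewrite /= raddfD sP (fg X _).2 ?add0r //; exists (pA X x.1).
exists (mod_ker p), (mod_sum PA PC), (ker_inc p), p; split.
- exact: sum_projective.
- exact: ker_inc_inj.
- exact: ker_inc_exact.
- move=> X b; have [c cP] := pC_epi X (g X b).
  have [a aP] : exists a, f X a = b - s X c.
    by apply/(fg X); rewrite raddfB sP cP subrr.
  have [a' a'P] := pA_epi X a.
  by exists (a', c); rewrite /= a'P aP subrK.
have [|u uP] := mod_lift (t := mod_comp (sum_in1 PA PC) iA)
   (@ker_inc_inj _ _ p) (@ker_inc_exact _ _ p).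
  by move=> X x; rewrite /= raddf0 addr0 (iAp X (iA X x)).2 ?raddf0 //;
    exists x.
have [|v vP] := mod_lift (t := mod_comp (sum_pr2 PA PC) (ker_inc p)) iC_inj iCp.
  by move=> X x; rewrite -[LHS](gp X (val x)) kernelK raddf0.
apply: (IH KA (mod_ker p) KC u v) => //.
- apply: mod_injP => X m um0.
  have := uP X m; rewrite um0 raddf0 => /(congr1 fst)/= /esym iA0.
  by apply: (iA_inj X); rewrite raddf0.
- move=> X m; split=> [vm0|[k <-]].
    have m2 : (val m).2 = 0 by have := vP X m; rewrite vm0 raddf0.
    have m1 : pA X (val m).1 = 0.
      apply: (f_inj X); rewrite raddf0.
      by have := kernelK m; rewrite /= m2 raddf0 addr0.
    have [k kP] := (iAp X _).1 m1; exists k.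
    apply: val_inj; rewrite [LHS](uP X k) /= kP.
    by rewrite [RHS]surjective_pairing m2.
  by apply: (iC_inj X); rewrite vP /= [val _](uP X k) raddf0.
- move=> X k.
  have s0 : g X (s X (iC X k)) = 0 by rewrite sP; apply/(iCp X); exists k.
  have [a aP] := (fg X _).1 s0; have [a' a'P] := pA_epi X a.
  have ker' : (- a', iC X k) \in kernel_pred (p X).
    by apply/eqP; rewrite /= !raddfN a'P aP addNr.
  by exists (Kernel ker'); apply: (iC_inj X); rewrite vP.
Qed.

Lemma sum_ext M N :
  [/\ mod_inj (sum_in1 M N), mod_exact (sum_in1 M N) (sum_pr2 M N)
    & mod_epi (sum_pr2 M N)].
Proof.
split=> X; first by move=> x y [].
  by move=> [x y]; split=> /= [->|[m [_ <-]]] //; exists x.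
by move=> y; exists (0, y).
Qed.

Lemma pd_le_sum n M N : pd_le n M -> pd_le n N -> pd_le n (mod_sum M N).
Proof. by case: (sum_ext M N) => ? ? ?; apply: pd_le_ext. Qed.

(** Let [e] be a lift to [P] of the idempotent [j \o r] of [N]. On the kernel
    [Y] of [P -> N -> M], the identity is [(2e - e^2) + (1 - e)^2]: [2e - e^2]
    sends [Y] into [K], so [Y] is a retract of [K + P] through (2e - e^2, 1 -
    e) and (k, p) |-> k + (1 - e) p, and the induction proceeds without
    comparing resolutions of [M] and [N]. *)
Lemma pd_le_retract n M N : mod_retract M N -> pd_le n N -> pd_le n M.
Proof.
elim: n M N => [|n IH] M N; first exact: retract_projective.
move=> [j [r rj]] [K [P [i [q [P_proj i_inj iq q_epi K_n]]]]].
pose rq := mod_comp r q.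
exists (mod_ker rq), P, (ker_inc rq), rq; split=> //.
- exact: ker_inc_inj.
- exact: ker_inc_exact.
- by move=> X m; have [x xP] := q_epi X (j X m); exists x; rewrite /= xP rj.
apply: (IH _ (mod_sum K P)); last first.
  by apply: pd_le_sum K_n _; apply: (@pd_le_mono 0).
have [e eP] := P_proj _ _ q (mod_comp j rq) q_epi.
have eP' X x : q X (e X x) = j X (r X (q X x)) := eP X x.
pose ie := ker_inc rq.
have ieP X x : r X (q X (ie X x)) = 0 by exact: (@kernelK _ _ (rq X) x).
have iqP X k : q X (i X k) = 0 by apply/(iq X); exists k.
pose t := mod_comp (mod_sub (mod_add e e) (mod_comp e e)) ie.
have qt X x : q X (t X x) = 0.
  have /= ie0 := ieP X x.
  by rewrite /= raddfB raddfD !eP' ie0 !raddf0 !addr0.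
have [u uP] := mod_lift i_inj iq qt.
pose w := mod_add (mod_comp i (sum_pr1 K P))
      (mod_comp (mod_sub (mod_id P) e) (sum_pr2 K P)).
have rqw X x : rq X (w X x) = 0.
  by rewrite /= !raddfD !raddfN iqP eP' rj raddf0 subrr addr0.
have [v vP] := mod_lift (@ker_inc_inj _ _ rq) (@ker_inc_exact _ _ rq) rqw.
exists (mod_add (mod_comp (sum_in1 K P) u)
   (mod_comp (sum_in2 K P) (mod_comp (mod_sub (mod_id P) e) ie))), v => X x.
apply: (@ker_inc_inj _ _ rq); rewrite vP.
have -> : ker_inc rq X x = ie X x by [].
move: (uP X x); rewrite /t /= => uP'.
rewrite addr0 add0r uP' raddfB.
set y := kernel_val x; set a := e X y; set b := e X a.
by rewrite -[a + a - b]addrA addrACA subrr addr0 addrC subrK.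
Qed.

Lemma bijective_inverse M N (f : mod_hom M N) :
  mod_inj f -> mod_epi f ->
  exists g : mod_hom N M, forall X n, f X (g X n) = n.
Proof.
move=> f_inj f_epi.
have nat0 X Y (h : orbit_hom X Y) (m : N Y) :
  (\0 : {additive N X -> N X}) (mod_map N h m) =
   mod_map N h ((\0 : {additive N Y -> N Y}) m) by rewrite /= raddf0.
(* [f] is a kernel of the zero map [z]. *)
pose z := @ModHom G N N _ nat0.
have [|//|g gP] := @mod_lift M N N f z N (mod_id N) f_inj.
  by move=> X n; split=> // _; exact: f_epi.
by exists g.
Qed.

(** If the first two terms of a short exact sequence have projective dimension
    at most [n], the third has projective dimension at most [n + 1]. *)
Lemma pd_le_cone n A B C (f : mod_hom A B) (g : mod_hom B C) :
  mod_inj f -> mod_exact f g -> mod_epi g ->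
  pd_le n A -> pd_le n B -> pd_le n.+1 C.
Proof.
case: n => [|n] f_inj fg g_epi A_n; first by move=> B_proj; exists A, B, f, g.
move=> [K [P [i [p [P_proj i_inj ip p_epi K_n]]]]].
pose gp := mod_comp g p.
exists (mod_ker gp), P, (ker_inc gp), gp; split=> //.
- exact: ker_inc_inj.
- exact: ker_inc_exact.
- by move=> X c; have [b bP] := g_epi X c; have [x xP] := p_epi X b; exists x;
    rewrite /= xP.
have ip0 X k : p X (i X k) = 0 by apply/(ip X); exists k.
have [|u uP] := mod_lift (t := i) (@ker_inc_inj _ _ gp) (@ker_inc_exact _ _ gp).
  by move=> X k; rewrite /= ip0 raddf0.
(* [ker (g \o p)] is an extension of [A] by [K]. *)
have [|v vP] := mod_lift (t := mod_comp p (ker_inc gp)) f_inj fg.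
  by move=> X x; exact: (@kernelK _ _ (gp X) x).
apply: (@pd_le_ext n.+1 K (mod_ker gp) A u v) A_n => //; last exact: pd_leS.
- apply: mod_injP => X m um0; apply: (i_inj X).
  by rewrite -uP um0 !raddf0.
- move=> X m; split=> [vm0|[k <-]].
    have /(ip X)[k kP] : p X (val m) = 0 by have := vP X m; rewrite vm0 raddf0.
    by exists k; apply: val_inj; rewrite [LHS](uP X k).
  by apply: (f_inj X); rewrite vP /= [kernel_val _](uP X k) ip0 raddf0.
- move=> X a; have [x xP] := p_epi X (f X a).
  have x0 : x \in kernel_pred (gp X).
    by apply/eqP; rewrite /= xP; apply/(fg X); exists a.
  by exists (Kernel x0); apply: (f_inj X); rewrite vP.
Qed.

(** A module with a resolution of length [n] by modules of projective dimension
    at most [d] has projective dimension at most [d + n]. *)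
Lemma pd_le_resolution d n (N : nat -> orbit_mod G)
    (D : forall k, mod_hom (N k.+1) (N k)) M (e : mod_hom (N 0) M) :
  (forall k, pd_le d (N k)) -> (forall k, (n < k)%N -> mod_zero (N k)) ->
  mod_epi e -> mod_exact (D 0) e -> (forall k, mod_exact (D k.+1) (D k)) ->
  pd_le (d + n) M.
Proof.
elim: n N D M e => [|n IH] N D M e N_d N0 e_epi De DD.
  rewrite addn0; apply: pd_le_retract (N_d 0).
  have e_inj : mod_inj e.
    apply: mod_injP => X m /(De X m)[x <-].
    by rewrite (N0 1 isT X x) raddf0.
  have [g gP] := bijective_inverse e_inj e_epi.
  by exists g, e.
rewrite addnS; pose K := mod_ker e.
have [|c cP] := mod_lift (t := D 0) (@ker_inc_inj _ _ e) (@ker_inc_exact _ _ e).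
  by move=> X x; apply/(De X); exists x.
have K_pd : pd_le (d + n) K.
  apply: (IH (fun k => N k.+1) (fun k => D k.+1) K c) => //.
  - by move=> k nk; apply: N0.
  - move=> X k; have [x xP] := (De X (val k)).1 (kernelK k).
    by exists x; apply: val_inj; rewrite -[RHS]xP; exact: cP.
  - move=> X x; split=> [c0|].
      by apply/(DD 0 X); rewrite -cP c0 raddf0.
    by move=> /(DD 0 X) D0; apply: val_inj; rewrite [LHS](cP X x).
apply: (pd_le_cone (@ker_inc_inj _ _ e) (@ker_inc_exact _ _ e) e_epi) => //.
by apply: pd_le_mono (N_d 0); exact: leq_addr.
Qed.

Lemma pd_le_of_resolution n M : has_proj_resolution M n -> pd_le n M.
Proof.
move=> [P [D [e [P_proj P0 e_epi De DD]]]].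
exact: (@pd_le_resolution 0 n P D M e).
Qed.

Lemma resolution_of_pd_le n M : pd_le n M -> has_proj_resolution M n.
Proof.
elim: n M => [|n IH] M.
  move=> M_proj.
  pose Z := mod_ker (mod_id M).
  have Z0 : mod_zero Z.
    by move=> X m; apply: val_inj; exact: (@kernelK _ _ (mod_id M X) m).
  pose P k := if k is _.+1 then Z else M.
  pose D k : mod_hom (P k.+1) (P k) :=
    match k with 0 => ker_inc _ | _.+1 => mod_id Z end.
  exists P, D, (mod_id M); split=> //.
  - by case=> [|k]; [exact: M_proj|exact: zero_projective].
  - by case.
  - by move=> X m; exists m.
  - exact: ker_inc_exact.
  - by move=> k X x; rewrite (Z0 X x); split=> _; [exists 0|]; rewrite raddf0.
move=> [K [P0 [i [p [P0_proj i_inj ip p_epi]]]]].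
move=> /IH[P [D [e [P_proj Pz e_epi De DD]]]].
pose P' k := if k is j.+1 then P j else P0.
pose D' k : mod_hom (P' k.+1) (P' k) :=
  match k with 0 => mod_comp i e | j.+1 => D j end.
exists P', D', p; split=> //.
- by case.
- by case=> // k; exact: Pz.
- move=> X x; split=> [/(ip X)[k <-]|[y <-]].
    by have [y <-] := e_epi X k; exists y.
  by apply/(ip X); exists (e X y).
- case=> [|k]; last exact: DD.
  move=> X x; split=> [ie0|/(De X) e0]; last by rewrite /= e0 raddf0.
  by apply/(De X)/(i_inj X); rewrite raddf0.
Qed.

End Modules.

(** * Direct sums of abelian groups *)

Section DirectSum.
Local Open Scope ring_scope.
Variables (I : choiceType) (A : I -> zmodType).

(** The direct sum of a family of abelian groups: the dependent functions with
    finite support. *)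
Record dsum := Dsum {
  dsum_val :> forall i, A i;
  dsum_finite : exists s : seq I, forall i, i \notin s -> dsum_val i = 0
}.

Lemma dsum_ext (a b : dsum) : (forall i, a i = b i) -> a = b.
Proof.
case: a b => [a fa] [b fb] /= ab;
  have {}ab : a = b by exact: functional_extensionality_dep.
by subst b; congr Dsum; exact: Prop_irrelevance.
Qed.

HB.instance Definition _ := gen_eqMixin dsum.
HB.instance Definition _ := gen_choiceMixin dsum.

Definition dsum_zero : dsum.
Proof. by exists (fun=> 0); exists [::]. Defined.

Definition dsum_opp (a : dsum) : dsum.
Proof.
by exists (fun i => - a i); have [s sP] := dsum_finite a; exists s => i /sP ->;
  rewrite oppr0.
Defined.

Definition dsum_add (a b : dsum) : dsum.
Proof.
exists (fun i => a i + b i).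
have [s sP] := dsum_finite a; have [t tP] := dsum_finite b.
by exists (s ++ t) => i; rewrite mem_cat negb_or => /andP[/sP-> /tP->];
  rewrite addr0.
Defined.

Lemma dsum_addA : associative dsum_add.
Proof. by move=> a b c; apply: dsum_ext => i; rewrite /= addrA. Qed.
Lemma dsum_addC : commutative dsum_add.
Proof. by move=> a b; apply: dsum_ext => i; rewrite /= addrC. Qed.
Lemma dsum_add0 : left_id dsum_zero dsum_add.
Proof. by move=> a; apply: dsum_ext => i; rewrite /= add0r. Qed.
Lemma dsum_addN : left_inverse dsum_zero dsum_opp dsum_add.
Proof. by move=> a; apply: dsum_ext => i; rewrite /= addNr. Qed.

HB.instance Definition _ :=
  GRing.isZmodule.Build dsum dsum_addA dsum_addC dsum_add0 dsum_addN.

Lemma dsumB (a b : dsum) i : (a - b) i = a i - b i. Proof. by []. Qed.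

(** The value at [j] of the element [x] of the summand of index [i]. *)
Definition dsum_in_fun i (x : A i) j : A j :=
  if pselect (i = j) is left e then eq_rect i A x j e else 0.

Lemma dsum_in_fun_eq i (x : A i) : dsum_in_fun x i = x.
Proof.
by rewrite /dsum_in_fun; case: pselect => // e;
  rewrite (Prop_irrelevance e erefl).
Qed.

Lemma dsum_in_fun_neq i (x : A i) j : i != j -> dsum_in_fun x j = 0.
Proof. by rewrite /dsum_in_fun; case: pselect => // e /eqP/(_ e). Qed.

Lemma dsum_in_finite i (x : A i) :
  exists s : seq I, forall j, j \notin s -> dsum_in_fun x j = 0.
Proof.
by exists [:: i] => j; rewrite inE eq_sym; exact: dsum_in_fun_neq.
Qed.

Lemma dsum_in_morphism i : zmod_morphism
    (fun x : A i => Dsum (dsum_in_finite x)).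
Proof.
move=> x y; apply: dsum_ext => j; rewrite dsumB /=.
have [<-|ij] := eqVneq i j; first by rewrite !dsum_in_fun_eq.
by rewrite !dsum_in_fun_neq // subr0.
Qed.

Definition dsum_in i : {additive A i -> dsum} := additive_of
    (@dsum_in_morphism i).

(** Equality in the total space of the family, which copes with indices that
    are equal without being convertible. *)
Lemma dsum_in_eq i j (x : A i) (y : A j) :
  existT A i x = existT A j y -> dsum_in i x = dsum_in j y.
Proof. by move=> /(congr1 (fun p => dsum_in (projT1 p) (projT2 p))). Qed.

Section Out.
Variables (B : zmodType) (h : forall i, {additive A i -> B}).

(** The map out of the direct sum given by a family of maps on the summands. *)
Definition dsum_out_fun (a : dsum) : B :=
  \sum_(i <- undup (sval (cid (dsum_finite a)))) h i (a i).

Lemma dsum_outE (s : seq I) (a : dsum) :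
  uniq s -> (forall i, i \notin s -> a i = 0) ->
  dsum_out_fun a = \sum_(i <- s) h i (a i).
Proof.
move=> s_uniq sP; rewrite /dsum_out_fun; case: cid => /= t tP.
pose nz i := a i != 0.
have sum_nz r : \sum_(i <- r) h i (a i) = \sum_(i <- filter nz r) h i (a i).
  rewrite big_filter [LHS](bigID nz)/= [X in _ + X]big1 ?addr0 // => i.
  by rewrite negbK => /eqP->; rewrite raddf0.
rewrite sum_nz [RHS]sum_nz; apply: perm_big; apply: uniq_perm.
- by rewrite filter_uniq // undup_uniq.
- exact: filter_uniq.
move=> i; rewrite !mem_filter mem_undup /nz.
case: (boolP (a i != 0)) => //= ai.
have -> : i \in t by apply: contraNT ai => /tP ai0; apply/eqP.
by symmetry; apply: contraNT ai => /sP ai0; apply/eqP.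
Qed.

Lemma dsum_out_morphism : zmod_morphism dsum_out_fun.
Proof.
move=> a b; have [s sP] := dsum_finite a; have [t tP] := dsum_finite b.
pose r := undup (s ++ t).
have rP i : i \notin r -> a i = 0 /\ b i = 0.
  by rewrite mem_undup mem_cat negb_or => /andP[/sP -> /tP ->].
rewrite !(@dsum_outE r) ?undup_uniq//; try by move=> i /rP[].
  by rewrite -sumrB; apply: eq_bigr => i _; rewrite dsumB raddfB.
by move=> i /rP[a0 b0]; rewrite dsumB a0 b0 subr0.
Qed.

Definition dsum_out : {additive dsum -> B} := additive_of dsum_out_morphism.

Lemma dsum_out_in i (x : A i) : dsum_out (dsum_in i x) = h i x.
Proof.
rewrite [LHS](@dsum_outE [:: i]) //;
  first by rewrite big_seq1 /= dsum_in_fun_eq.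
by move=> j; rewrite inE eq_sym => ij; exact: dsum_in_fun_neq.
Qed.

End Out.

Lemma dsum_sum_in (s : seq I) (a : dsum) :
  uniq s -> (forall i, i \notin s -> a i = 0) ->
  a = \sum_(i <- s) dsum_in i (a i).
Proof.
move=> s_uniq sP; apply: dsum_ext => j.
have -> : (\sum_(i <- s) dsum_in i (a i)) j = \sum_(i <- s) dsum_in i (a i) j.
  by elim/big_rec2: _ => // i x y _ <-.
have [js|js] := boolP (j \in s); last first.
  rewrite sP // big_seq big1 // => i si; apply: dsum_in_fun_neq.
  by apply: contraNneq js => <-.
rewrite (bigD1_seq j) //= dsum_in_fun_eq big1 ?addr0 // => i ij.
exact: dsum_in_fun_neq.
Qed.

(** A direct sum is generated by its summands. *)
Lemma dsum_additive_ext (B : zmodType) (f g : {additive dsum -> B}) :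
  (forall i x, f (dsum_in i x) = g (dsum_in i x)) -> forall a, f a = g a.
Proof.
move=> fg a; have [s sP] := dsum_finite a.
have {}sP i : i \notin undup s -> a i = 0 by rewrite mem_undup; exact: sP.
rewrite (dsum_sum_in (undup_uniq s) sP) !raddf_sum.
by apply: eq_bigr => i _; exact: fg.
Qed.

End DirectSum.

Section DirectSumMap.
Local Open Scope ring_scope.
Variables (I : choiceType).

Section Map.
Variables (A B : I -> zmodType) (h : forall i, {additive A i -> B i}).

Lemma dsum_map_finite (a : dsum A) :
  exists s : seq I, forall i, i \notin s -> h i (a i) = 0.
Proof. by have [s sP] := dsum_finite a; exists s => i /sP->;
  rewrite raddf0. Qed.

Lemma dsum_map_morphism : zmod_morphism (fun a => Dsum (dsum_map_finite a)).
Proof. by move=> a b; apply: dsum_ext => i; rewrite /= raddfB. Qed.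

Definition dsum_map : {additive dsum A -> dsum B} :=
    additive_of dsum_map_morphism.

Lemma dsum_map_in i (x : A i) : dsum_map (dsum_in A i x) = dsum_in B i (h i x).
Proof.
apply: dsum_ext => j /=; have [<-|ij] := eqVneq i j.
  by rewrite !dsum_in_fun_eq.
by rewrite !dsum_in_fun_neq // raddf0.
Qed.

Lemma dsum_map_epi :
  (forall i y, exists x, h i x = y) -> forall b, exists a, dsum_map a = b.
Proof.
move=> h_epi b.
(* 0 is the preimage chosen for 0, so that the support stays finite. *)
pose a i := if pselect (b i = 0) then 0 else sval (cid (h_epi i (b i))).
have ab i : h i (a i) = b i.
  by rewrite /a; case: pselect => [bi|_] /=; [rewrite raddf0|case: cid].
have a_fin : exists s : seq I, forall i, i \notin s -> a i = 0.
  have [s sP] := dsum_finite b; exists s => i /sP bi.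
  by rewrite /a; case: pselect.
by exists (Dsum a_fin); apply: dsum_ext => i; exact: ab.
Qed.

End Map.

Lemma dsum_map_exact (A B C : I -> zmodType)
    (f : forall i, {additive A i -> B i})
    (g : forall i, {additive B i -> C i}) :
  (forall i y, g i y = 0 <-> exists x, f i x = y) ->
  forall b, dsum_map g b = 0 <-> exists a, dsum_map f a = b.
Proof.
move=> fg b; split=> [gb0|[a <-]]; last first.
  by apply: dsum_ext => i /=; apply/fg; exists (a i).
have b_im i : exists x, f i x = b i.
  by apply/fg; have := congr1 (fun c : dsum C => c i) gb0.
pose a i := if pselect (b i = 0) then 0 else sval (cid (b_im i)).
have ab i : f i (a i) = b i.
  by rewrite /a; case: pselect => [bi|_] /=; [rewrite raddf0|case: cid].
have a_fin : exists s : seq I, forall i, i \notin s -> a i = 0.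
  have [s sP] := dsum_finite b; exists s => i /sP bi.
  by rewrite /a; case: pselect.
by exists (Dsum a_fin); apply: dsum_ext => i; exact: ab.
Qed.

End DirectSumMap.

(** * Orbits and functors between orbit categories *)

Section Orbits.
Local Open Scope group_scope.
Local Open Scope quotient_scope.
Variable G : groupType.
Implicit Types X Y Z : orbit G.

(** The point gS of the orbit G/S. *)
Definition orbit_pt X (g : G) : orbit_set X := \pi_(coset (orbit_stab X)) g.

Lemma orbit_pt_eq X (x y : G) :
  orbit_pt X x = orbit_pt X y <-> x^-1 * y \in orbit_stab X.
Proof. by split=> [/eqquotP|H]; last apply/eqquotP. Qed.

Lemma orbit_pt_repr X (u : orbit_set X) : orbit_pt X (repr u) = u.
Proof. exact: reprK. Qed.

Lemma orbit_ptJ X (g x : G) : coset_act g (orbit_pt X x) = orbit_pt X (g * x).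
Proof. exact: coset_act_pi. Qed.

(** A group element representing the map [f] of orbits: if x = hom_elt f, then
    [f] sends gS to gxT. *)
Definition hom_elt X Y (f : orbit_hom X Y) : G := repr (f (orbit_pt X 1)).

Lemma orbit_funE X Y (f : orbit_hom X Y) g :
  f (orbit_pt X g) = orbit_pt Y (g * hom_elt f).
Proof.
have -> : orbit_pt X g = coset_act g (orbit_pt X 1) by rewrite orbit_ptJ mulg1.
by rewrite orbit_funJ -orbit_ptJ orbit_pt_repr.
Qed.

Lemma orbit_hom_ext X Y (f h : orbit_hom X Y) :
  f (orbit_pt X 1) = h (orbit_pt X 1) -> f = h.
Proof.
move=> fh; have {fh} : orbit_fun f = orbit_fun h.
  apply: functional_extensionality_dep => u; rewrite -[u]orbit_pt_repr.
  by rewrite -[repr _]mulg1 -orbit_ptJ !orbit_funJ fh.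
case: f h => [f fJ] [h hJ] /= fh; subst h; congr OrbitHom;
  exact: Prop_irrelevance.
Qed.

Lemma orbit_compE X Y Z (f : orbit_hom Y Z) (h : orbit_hom X Y) u :
  orbit_comp f h u = f (h u).
Proof. by []. Qed.

Lemma hom_elt_stab X Y (f : orbit_hom X Y) s :
  s \in orbit_stab X -> (hom_elt f)^-1 * s * hom_elt f \in orbit_stab Y.
Proof.
move=> sX; rewrite -mulgA; apply/orbit_pt_eq.
rewrite -[X in orbit_pt _ X]mul1g -!orbit_funE; congr (f _).
by apply/orbit_pt_eq; rewrite invg1 mul1g.
Qed.

(** Conversely, gS |-> gxT is a map of orbits as soon as x^-1 S x is contained
    in T. *)
Section MkHom.
Variables (X Y : orbit G) (x : G).
Hypothesis xP : forall s, s \in orbit_stab X -> x^-1 * s * x \in orbit_stab Y.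

Lemma orbit_mk_pt (g : G) :
  orbit_pt Y (repr (orbit_pt X g) * x) = orbit_pt Y (g * x).
Proof.
apply/orbit_pt_eq; rewrite invgM -!mulgA [_ * (g * x)]mulgA mulgA.
by apply: xP; apply/orbit_pt_eq; rewrite orbit_pt_repr.
Qed.

Lemma orbit_mk_funJ (g : G) (u : orbit_set X) :
  orbit_pt Y (repr (coset_act g u) * x) = coset_act g (orbit_pt Y (repr u * x)).
Proof.
by rewrite -[u in coset_act g u]orbit_pt_repr !orbit_ptJ orbit_mk_pt mulgA.
Qed.

Definition orbit_mk : orbit_hom X Y :=
  @OrbitHom G X Y (fun u => orbit_pt Y (repr u * x)) orbit_mk_funJ.

Lemma orbit_mkE g : orbit_mk (orbit_pt X g) = orbit_pt Y (g * x).
Proof. exact: orbit_mk_pt. Qed.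

End MkHom.
End Orbits.

Section Push.
Local Open Scope group_scope.
Variables (A B : groupType) (phi : UMagmaMorphism.type A B).

Section Pred.
Variable S : groupClosed A.
(** The image of a subgroup. *)
Definition image_subg : {pred B} := fun b =>
    `[< exists2 a, a \in S & phi a = b >].

Lemma image_subgP b : reflect (exists2 a, a \in S & phi a = b)
    (b \in image_subg).
Proof. exact: asboolP. Qed.

Lemma image_subgM : mulg_closed image_subg.
Proof.
move=> _ _ /image_subgP[x xS <-] /image_subgP[y yS <-].
by apply/image_subgP; exists (x * y); rewrite ?gmulfM // gpredM.
Qed.
Lemma image_subg1 : 1 \in image_subg.
Proof. by apply/image_subgP; exists 1; rewrite ?gmulf1 ?gpred1. Qed.
Lemma image_subgV : invg_closed image_subg.
Proof.
by move=> _ /image_subgP[x xS <-]; apply/image_subgP; exists x^-1;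
  rewrite ?gmulfV ?gpredV.
Qed.
HB.instance Definition _ := isMulClosed.Build B image_subg image_subgM.
HB.instance Definition _ := isMul1Closed.Build B image_subg image_subg1.
HB.instance Definition _ := isInvClosed.Build B image_subg image_subgV.

Lemma image_subg_finite : finite_subg S -> finite_subg image_subg.
Proof.
move=> Sfin; apply: sub_finite_set (finite_image phi Sfin) => b /=.
by move=> /image_subgP[a aS <-]; exists a.
Qed.
End Pred.

(** The functor A/K |-> B/phi(K) induced by a group morphism phi, on objects
    and then on morphisms. *)
Definition push (X : orbit A) : orbit B := Orbit
    (image_subg_finite (orbit_finite X)).

Lemma mem_push (X : orbit A) a : a \in orbit_stab X -> phi a \in orbit_stab
    (push X).
Proof. by move=> aX; apply/image_subgP; exists a. Qed.

Lemma push_hom_subproof X Y (f : orbit_hom X Y) s :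
  s \in orbit_stab (push X) ->
  (phi (hom_elt f))^-1 * s * phi (hom_elt f) \in orbit_stab (push Y).
Proof.
move=> /image_subgP[a aX <-]; rewrite -gmulfV -!gmulfM; apply: mem_push.
exact: hom_elt_stab.
Qed.

Definition push_hom X Y (f : orbit_hom X Y) : orbit_hom (push X) (push Y) :=
  orbit_mk (@push_hom_subproof X Y f).

Lemma push_homE X Y (f : orbit_hom X Y) (a : A) :
  f (orbit_pt X 1) = orbit_pt Y a ->
  push_hom f (orbit_pt (push X) 1) = orbit_pt (push Y) (phi a).
Proof.
rewrite [push_hom f _]orbit_mkE mul1g orbit_funE mul1g => /orbit_pt_eq fa.
by apply/orbit_pt_eq; rewrite -gmulfV -gmulfM; exact: mem_push.
Qed.

Lemma push_id X : push_hom (orbit_id X) = orbit_id (push X).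
Proof. by apply: orbit_hom_ext; rewrite (@push_homE _ _ _ 1) //= gmulf1. Qed.

Lemma push_comp X Y Z (f : orbit_hom Y Z) (h : orbit_hom X Y) :
  push_hom (orbit_comp f h) = orbit_comp (push_hom f) (push_hom h).
Proof.
apply: orbit_hom_ext; rewrite (@push_homE _ _ _ (hom_elt h * hom_elt f)).
  by rewrite orbit_compE [push_hom h _]orbit_mkE mul1g [RHS]orbit_mkE gmulfM.
by rewrite orbit_compE !orbit_funE mul1g.
Qed.

(** Precomposition with [push phi]; for an inclusion phi, this is the
    restriction of modules to a subgroup. *)
Section Pull.
Variable M : orbit_mod B.
Definition mod_pull : orbit_mod A.
refine (@OrbitMod A (fun X => M (push X))
  (fun X Y f => mod_map M (push_hom f)) _ _).
  by move=> X m; rewrite push_id mod_map_id.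
by move=> X Y Z f h m; rewrite push_comp mod_map_comp.
Defined.
End Pull.

Definition mod_pull_hom M N (f : mod_hom M N) : mod_hom (mod_pull M)
    (mod_pull N) :=
  @ModHom A (mod_pull M) (mod_pull N) (fun X => f (push X))
    (fun X Y h m => mod_fun_nat f (push_hom h) m).

End Push.

Section Conj.
Local Open Scope group_scope.
Variables (L G : groupType) (iota : UMagmaMorphism.type L G).
Hypothesis iota_inj : injective iota.

Section Pred.
Variables (S : groupClosed G) (x : G).
(** The subgroup of the l in L such that x l x^-1 lies in S, for L embedded in
    G: the intersection of L and x^-1 S x. *)
Definition conj_subg : {pred L} := fun l => x * iota l * x^-1 \in S.

Lemma conj_subgM : mulg_closed conj_subg.
Proof.
move=> a b; rewrite !unfold_in gmulfM => aS bS.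
by have := gpredM (s := S) _ _ aS bS; rewrite !mulgA mulgVK.
Qed.
Lemma conj_subg1 : 1 \in conj_subg.
Proof. by rewrite unfold_in gmulf1 mulg1 mulgV gpred1. Qed.
Lemma conj_subgV : invg_closed conj_subg.
Proof.
by move=> a aS; rewrite unfold_in -gpredV !invgM invgK gmulfV invgK mulgA.
Qed.
HB.instance Definition _ := isMulClosed.Build L conj_subg conj_subgM.
HB.instance Definition _ := isMul1Closed.Build L conj_subg conj_subg1.
HB.instance Definition _ := isInvClosed.Build L conj_subg conj_subgV.

Lemma conj_subg_finite : finite_subg S -> finite_subg conj_subg.
Proof.
move=> Sfin; have c_inj : injective (fun l => x * iota l * x^-1).
  by move=> a b /mulIg /mulgI /iota_inj.
apply: (@finite_preimage _ _ _ (fun l => x * iota l * x^-1)) Sfin => a b _ _;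
  exact: c_inj.
Qed.
End Pred.

Definition conj_orbit (X : orbit G) (x : G) : orbit L :=
  Orbit (conj_subg_finite x (orbit_finite X)).
End Conj.

(** Any type, with the choice structure provided by classical choice. *)
Definition classical_choiceType (T : Type) : choiceType := HB.pack T
    (gen_eqMixin T) (gen_choiceMixin T).

(** * Sums over presheaves and free modules *)

(** The sum of a family of abelian groups [A] indexed by the elements of a
    presheaf of sets [T] on the orbit category: its value at [X] is the direct
    sum of the [A t] for [t] in [T X]. The functoriality laws are stated in the
    total space of the family [A], since they compare summands whose indices
    are only propositionally equal. *)
Section FamilySum.
Local Open Scope ring_scope.
Variables (G : groupType) (T : orbit G -> Type) (A : forall X, T X -> zmodType).
Variables (act : forall X Y, orbit_hom X Y -> T Y -> T X)
  (amap : forall X Y (f : orbit_hom X Y) t, {additive A t -> A (act f t)}).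
Hypothesis act_id : forall X (t : T X) (a : A t),
  existT (@A X) _ (amap (orbit_id X) t a) = existT (@A X) t a.
Hypothesis act_comp : forall X Y Z (f : orbit_hom Y Z) (h : orbit_hom X Y) t
  (a : A t),
  existT (@A X) _ (amap (orbit_comp f h) t a) =
  existT (@A X) _ (amap h (act f t) (amap f t a)).

Definition fam_in X (t : T X) :
    {additive A t -> dsum (I := classical_choiceType (T X)) (@A X)} :=
  dsum_in (I := classical_choiceType (T X)) (@A X) t.

Definition fam_map X Y (f : orbit_hom X Y) :=
  dsum_out (fun t : classical_choiceType (T Y) => fam_in (act f t) \o
    amap f t : {additive _ -> _}).

Lemma fam_map_in X Y (f : orbit_hom X Y) t a :
  fam_map f (fam_in t a) = fam_in (act f t) (amap f t a).
Proof. exact: dsum_out_in. Qed.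

Lemma fam_map_id X a : fam_map (orbit_id X) a = a.
Proof.
apply: (@dsum_additive_ext _ _ _ (fam_map (orbit_id X)) idfun) => t b.
by rewrite [LHS]fam_map_in; apply: (@dsum_in_eq (classical_choiceType (T X)));
  exact: act_id.
Qed.

Lemma fam_map_comp X Y Z (f : orbit_hom Y Z) (h : orbit_hom X Y) a :
  fam_map (orbit_comp f h) a = fam_map h (fam_map f a).
Proof.
apply: (@dsum_additive_ext _ _ _ (fam_map (orbit_comp f h))
  (fam_map h \o fam_map f)) => t b.
rewrite [LHS]fam_map_in; apply: etrans
  (esym (congr1 (fam_map h) (fam_map_in f b))).
by rewrite [RHS]fam_map_in; apply: (@dsum_in_eq (classical_choiceType (T X)));
  exact: act_comp.
Qed.

Definition fam_sum : orbit_mod G :=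
  @OrbitMod G (fun X => dsum (I := classical_choiceType (T X))
    (@A X)) fam_map fam_map_id fam_map_comp.

End FamilySum.

(** The free module on the elements of [R], with its surjection onto [R]: an
    element m of R Y contributes a copy of Z[-, Y], whose value at [X] is the
    free abelian group on the maps from [X] to [Y]. *)
Section Cover.
Local Open Scope ring_scope.
Variables (G : groupType) (R : orbit_mod G).

(** The maps from [X] to some member of a family of orbits, on which maps of
    orbits act by composition. *)
Definition cover_idx (I : Type) (Y : I -> orbit G) (X : orbit G) : Type :=
    {i : I & orbit_hom X (Y i)}.
Definition cover_act (I : Type) (Y : I -> orbit G) X Z (f : orbit_hom X Z)
  (t : cover_idx Y Z) : cover_idx Y X := existT _ (projT1 t)
    (orbit_comp (projT2 t) f).
(** The elements of [R], over all orbits. *)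
Definition mod_elt : Type := {Y : orbit G & R Y}.
Definition mod_elt_orbit (i : mod_elt) : orbit G := projT1 i.

Lemma orbit_comp_id1 (X Y : orbit G) (f : orbit_hom X Y) : orbit_comp f
    (orbit_id X) = f.
Proof. by apply: orbit_hom_ext. Qed.

Lemma orbit_compA (X Y Z V : orbit G) (f : orbit_hom Z V) (g : orbit_hom Y Z)
    (h : orbit_hom X Y) :
  orbit_comp f (orbit_comp g h) = orbit_comp (orbit_comp f g) h.
Proof. by apply: orbit_hom_ext. Qed.

Definition free_cover : orbit_mod G.
refine (@fam_sum G (cover_idx mod_elt_orbit) (fun _ _ => int)
  (cover_act (Y := mod_elt_orbit))
  (fun _ _ _ _ => idfun) _ _).
  by move=> X [i phi] a; rewrite /cover_act /= orbit_comp_id1.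
by move=> X Y Z f h [i phi] a; rewrite /cover_act /= orbit_compA.
Defined.

Definition cover_in X (t : cover_idx mod_elt_orbit X) :
    {additive int -> free_cover X} :=
  @fam_in G (cover_idx mod_elt_orbit) (fun _ _ => int) X t.

Lemma cover_map_in X Y (f : orbit_hom X Y) (t : cover_idx mod_elt_orbit Y)
    (n : int) :
  mod_map free_cover f (cover_in t n) = cover_in (cover_act f t) n.
Proof. exact: dsum_out_in. Qed.

Definition cover_val X (t : cover_idx mod_elt_orbit X) : R X :=
  mod_map R (projT2 t) (projT2 (projT1 t)).

Lemma mulz_morphism (m : zmodType) (x : m) : zmod_morphism
    (fun n : int => x *~ n).
Proof. by move=> a b; rewrite mulrzBr. Qed.

Definition cover_fun X : {additive free_cover X -> R X} :=
  dsum_out (fun t : classical_choiceType (cover_idx mod_elt_orbit X) =>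
    additive_of (mulz_morphism (cover_val t))).

Lemma cover_fun_in X (t : cover_idx mod_elt_orbit X) (n : int) :
  cover_fun X (cover_in t n) = cover_val t *~ n.
Proof. exact: dsum_out_in. Qed.

Lemma cover_fun_nat X Y (f : orbit_hom X Y) (a : free_cover Y) :
  cover_fun X (mod_map free_cover f a) = mod_map R f (cover_fun Y a).
Proof.
apply: (@dsum_additive_ext _ _ _ (cover_fun X \o mod_map free_cover f)
  (mod_map R f \o cover_fun Y)) => t n.
rewrite [LHS](congr1 (cover_fun X) (cover_map_in f t n)) cover_fun_in.
rewrite [RHS](congr1 (mod_map R f) (cover_fun_in t n)) raddfMz.
by rewrite /cover_val /= mod_map_comp.
Qed.

Definition cover_hom : mod_hom free_cover R := ModHom cover_fun_nat.

Lemma cover_hom_epi : mod_epi cover_hom.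
Proof.
move=> X m; pose t : cover_idx mod_elt_orbit X :=
  existT _ (existT (fun Y => R Y) X m : mod_elt) (orbit_id X).
by exists (cover_in t 1);
  rewrite [LHS]cover_fun_in mulr1z /cover_val mod_map_id.
Qed.

End Cover.

(** * Induction *)

(** The map from L/(L cap x^-1 S x) to L/(L cap y^-1 T y) induced by a map of
    orbits [f] from G/S to G/T that sends gS to gaT, when x^-1 a y lies in L;
    it sends the base point to the class of x^-1 a y. *)
Section ConjHom.
Local Open Scope group_scope.
Variables (L G : groupType) (iota : UMagmaMorphism.type L G).
Hypothesis iota_inj : injective iota.

Lemma mem_conj (X : orbit G) x l :
  (l \in orbit_stab (conj_orbit iota_inj X x)) =
    (x * iota l * x^-1 \in orbit_stab X).
Proof. by []. Qed.

Variables (X Y : orbit G) (f : orbit_hom X Y) (x y : G).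
Hypothesis xy : exists l, iota l = x^-1 * hom_elt f * y.

Lemma conj_hom_subproof s :
  s \in orbit_stab (conj_orbit iota_inj X x) ->
  (sval (cid xy))^-1 * s * sval (cid xy) \in orbit_stab
    (conj_orbit iota_inj Y y).
Proof.
case: cid => l /= lE; rewrite !mem_conj !gmulfM gmulfV !lE => sX.
have -> : y * ((x^-1 * hom_elt f * y)^-1 * iota s *
  (x^-1 * hom_elt f * y)) * y^-1
  = (hom_elt f)^-1 * (x * iota s * x^-1) * hom_elt f.
  by rewrite !invgM invgK !mulgA mulgV mul1g mulgK.
exact: hom_elt_stab.
Qed.

Definition conj_hom : orbit_hom (conj_orbit iota_inj X x)
    (conj_orbit iota_inj Y y) :=
  orbit_mk conj_hom_subproof.

Lemma conj_homE g l :
  f (orbit_pt X 1) = orbit_pt Y g -> iota l = x^-1 * g * y ->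
  conj_hom (orbit_pt _ 1) = orbit_pt _ l.
Proof.
rewrite orbit_funE mul1g => /orbit_pt_eq fg lE.
rewrite [LHS]orbit_mkE mul1g; apply/orbit_pt_eq.
case: cid => l0 /= l0E; rewrite mem_conj gmulfM gmulfV lE !l0E.
have -> : y * ((x^-1 * hom_elt f * y)^-1 * (x^-1 * g * y)) * y^-1 =
  (hom_elt f)^-1 * g.
  by rewrite !invgM invgK !mulgA mulgV mul1g !mulgK.
exact: fg.
Qed.

End ConjHom.

Lemma orbit_fun_pt (G : groupType) (X Y : orbit G) (f : orbit_hom X Y) a b :
  f (orbit_pt X 1%g) = orbit_pt Y b -> f (orbit_pt X a) = orbit_pt Y (a * b)%g.
Proof. by move=> f1; rewrite -orbit_ptJ -f1 -orbit_funJ orbit_ptJ mulg1. Qed.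

(** Let Y_i = Q/F_i be a family of orbits of [Q], and let L_i be the inverse
    image of F_i under [pi], given through its embedding [iota i] in [G]. The
    module induced from a family of modules P_i over the L_i is G/K |-> the sum
    of the P_i (L_i/(L_i cap x^-1 K x)), over all i and all points x L_i of
    G/L_i fixed by K. Since G/L_i = Q/F_i, such points correspond to the maps
    Q/pi(K) -> Q/F_i; the representative x is a chosen lift of an element
    defining that map. *)
Section Induction.
Variables (G Q : groupType) (pi : UMagmaMorphism.type G Q).
Hypothesis pi_surj : forall q, exists g, pi g = q.
Variables (I : Type) (Y : I -> orbit Q) (L : I -> groupType).
Variable iota : forall i, UMagmaMorphism.type (L i) G.
Hypothesis iota_inj : forall i, injective (iota i).
Hypothesis iotaP : forall i g, pi g \in orbit_stab (Y i) <->
  exists l, iota i l = g.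

Section Indices.
Local Open Scope group_scope.

Definition ind_rep X i (phi : orbit_hom (push pi X) (Y i)) : G :=
  sval (cid (pi_surj (hom_elt phi))).

Lemma ind_repE X i (phi : orbit_hom (push pi X) (Y i)) : pi (ind_rep phi) =
    hom_elt phi.
Proof. by rewrite /ind_rep; case: cid. Qed.

Lemma ind_rep_pt X i (phi : orbit_hom (push pi X) (Y i)) g :
  phi (orbit_pt _ (pi g)) = orbit_pt (Y i) (pi (g * ind_rep phi)).
Proof. by rewrite orbit_funE gmulfM ind_repE. Qed.

Lemma ind_act_elt X Z i (f : orbit_hom X Z)
    (phi : orbit_hom (push pi Z) (Y i)) g :
  f (orbit_pt X 1) = orbit_pt Z g ->
  exists l, iota i l = (ind_rep
    (orbit_comp phi (push_hom pi f)))^-1 * g * ind_rep phi.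
Proof.
move=> fg; apply/iotaP; rewrite -mulgA gmulfM gmulfV; apply/orbit_pt_eq.
rewrite -ind_rep_pt -(push_homE pi fg) -orbit_compE.
by rewrite -[X in orbit_pt _ (pi X)]mul1g -ind_rep_pt gmulf1.
Qed.

Definition ind_orbit X (t : cover_idx Y (push pi X)) : orbit (L (projT1 t)) :=
  conj_orbit (@iota_inj (projT1 t)) X (ind_rep (projT2 t)).

Definition ind_act X Z (f : orbit_hom X Z) : cover_idx Y (push pi Z) ->
    cover_idx Y (push pi X) :=
  cover_act (push_hom pi f).

Lemma ind_hom_elt X Z (f : orbit_hom X Z) (t : cover_idx Y (push pi Z)) :
  exists l, iota (projT1 t) l =
    (ind_rep (projT2 (ind_act f t)))^-1 * hom_elt f * ind_rep (projT2 t).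
Proof. by apply: ind_act_elt; rewrite orbit_funE mul1g. Qed.

Definition ind_hom X Z (f : orbit_hom X Z) (t : cover_idx Y (push pi Z)) :
    orbit_hom (ind_orbit (ind_act f t)) (ind_orbit t) :=
  conj_hom (@iota_inj _) (ind_hom_elt f t).

Lemma ind_homE X Z (f : orbit_hom X Z) (t : cover_idx Y (push pi Z)) g l :
  f (orbit_pt X 1) = orbit_pt Z g ->
  iota (projT1 t) l = (ind_rep (projT2 (ind_act f t)))^-1 * g * ind_rep
    (projT2 t) ->
  ind_hom f t (orbit_pt _ 1) = orbit_pt (ind_orbit t) l.
Proof. exact: conj_homE. Qed.

End Indices.

Section Module.
Variable P : forall i, orbit_mod (L i).

(** Elements of the total space of summands, given as the restrictions of one
    element along two maps, agree once the indices and the values at the base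
    point do. *)
Lemma ind_summand_eq X i (phi1 phi2 : orbit_hom (push pi X) (Y i))
    (S : orbit (L i))
    (c1 : orbit_hom (ind_orbit (existT _ i phi1)) S)
    (c2 : orbit_hom (ind_orbit (existT _ i phi2)) S) (p : P i S) :
  phi1 = phi2 -> c1 (orbit_pt _ 1%g) = c2 (orbit_pt _ 1%g) ->
  existT (fun t => P _ (ind_orbit (X := X) t)) (existT _ i phi1)
    (mod_map (P i) c1 p) =
  existT (fun t => P _ (ind_orbit (X := X) t)) (existT _ i phi2)
    (mod_map (P i) c2 p).
Proof. by move=> e; subst phi2 => /orbit_hom_ext->. Qed.

Definition ind : orbit_mod G.
refine (@fam_sum G (fun X => cover_idx Y (push pi X))
  (fun X t => P _ (ind_orbit t))
  ind_act (fun X Z f t => mod_map (P (projT1 t)) (ind_hom f t)) _ _).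
  move=> X [i phi] a; rewrite -[in RHS](mod_map_id a).
  apply: ind_summand_eq; first by rewrite push_id orbit_comp_id1.
  rewrite (@ind_homE _ _ _ _ 1%g 1%g) //.
  by rewrite /= push_id orbit_comp_id1 mulg1 mulVg gmulf1.
move=> X Z V f h [i phi] a; rewrite /= -mod_map_comp.
apply: ind_summand_eq; first by rewrite push_comp orbit_compA.
set t := existT _ i phi.
have [lf lfE] := ind_hom_elt f t; have [lh lhE] := ind_hom_elt h (ind_act f t).
have hE : ind_hom h (ind_act f t) (orbit_pt _ 1%g) = orbit_pt _ lh.
  by apply: ind_homE lhE; rewrite orbit_funE mul1g.
have fE : ind_hom f t (orbit_pt _ 1%g) = orbit_pt _ lf.
  by apply: ind_homE lfE; rewrite orbit_funE mul1g.
apply: etrans (esym (etrans (congr1 (ind_hom f t) hE) (orbit_fun_pt lh fE))).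
refine (@ind_homE _ _ (orbit_comp f h) t (hom_elt h * hom_elt f)%g
  (lh * lf)%g _ _).
  by rewrite orbit_compE !orbit_funE mul1g.
rewrite gmulfM lfE lhE /= push_comp orbit_compA.
by rewrite !mulgA mulgK.
Defined.

(** The inclusion of the summand of index [phi]. *)
Definition ind_in X i (phi : orbit_hom (push pi X) (Y i)) :
    {additive P i (ind_orbit (existT _ i phi)) -> ind X} :=
  @fam_in G (fun X => cover_idx Y (push pi X)) (fun X t => P _ (ind_orbit t)) X
    (existT _ i phi).

Lemma ind_map_in X Z (f : orbit_hom X Z) i
    (phi : orbit_hom (push pi Z) (Y i)) p :
  mod_map ind f (ind_in phi p) =
  ind_in (orbit_comp phi (push_hom pi f))
    (mod_map (P i) (ind_hom f (existT _ i phi)) p).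
Proof. exact: dsum_out_in. Qed.

Lemma ind_in_eq X i (phi1 phi2 : orbit_hom (push pi X) (Y i)) (S : orbit (L i))
    (c1 : orbit_hom (ind_orbit (existT _ i phi1)) S)
    (c2 : orbit_hom (ind_orbit (existT _ i phi2)) S) (p : P i S) :
  phi1 = phi2 -> c1 (orbit_pt _ 1%g) = c2 (orbit_pt _ 1%g) ->
  ind_in phi1 (mod_map (P i) c1 p) = ind_in phi2 (mod_map (P i) c2 p).
Proof.
move=> e c12; apply: (@dsum_in_eq (classical_choiceType _));
  exact: ind_summand_eq.
Qed.

Lemma ind_ext X (B : zmodType) (f g : {additive ind X -> B}) :
  (forall i (phi : orbit_hom (push pi X) (Y i)) p, f (ind_in phi p) = g
    (ind_in phi p)) ->
  forall a, f a = g a.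
Proof. by move=> fg; apply: dsum_additive_ext => -[i phi] p; exact: fg. Qed.

End Module.

Section Maps.
Variables (P P' : forall i, orbit_mod (L i))
  (h : forall i, mod_hom (P i) (P' i)).

(** The map of induced modules given by a family of maps of modules. *)
Definition ind_fun X : {additive ind P X -> ind P' X} :=
  dsum_map (I := classical_choiceType (cover_idx Y (push pi X)))
    (fun t => h (projT1 t) (ind_orbit t)).

Lemma ind_fun_in X i (phi : orbit_hom (push pi X) (Y i)) p :
  ind_fun X (ind_in P phi p) = ind_in P' phi (h i _ p).
Proof. exact: dsum_map_in. Qed.

Lemma ind_fun_nat X Z (f : orbit_hom X Z) (a : ind P Z) :
  ind_fun X (mod_map (ind P) f a) = mod_map (ind P') f (ind_fun Z a).
Proof.
apply: (@ind_ext _ _ _ (ind_fun X \o mod_map (ind P) f)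
  (mod_map (ind P') f \o ind_fun Z)).
move=> i phi p; rewrite [LHS](congr1 (ind_fun X) (ind_map_in f p)) ind_fun_in.
rewrite [RHS](congr1 (mod_map (ind P') f) (ind_fun_in p)) ind_map_in.
by rewrite mod_fun_nat.
Qed.

Definition ind_mor : mod_hom (ind P) (ind P') := ModHom ind_fun_nat.

Lemma ind_mor_epi : (forall i, mod_epi (h i)) -> mod_epi ind_mor.
Proof. by move=> h_epi X; apply: dsum_map_epi => t y; exact: h_epi. Qed.

End Maps.

Lemma ind_mor_exact (A B C : forall i, orbit_mod (L i))
    (f : forall i, mod_hom (A i) (B i)) (g : forall i, mod_hom (B i) (C i)) :
  (forall i, mod_exact (f i) (g i)) -> mod_exact (ind_mor f) (ind_mor g).
Proof. by move=> fg X; apply: dsum_map_exact => t y; exact: fg. Qed.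

Lemma ind_zero (P : forall i, orbit_mod (L i)) :
  (forall i, mod_zero (P i)) -> mod_zero (ind P).
Proof. by move=> P0 X a; apply: dsum_ext => t; exact: P0. Qed.

(** Induction is left adjoint to restriction. For K fixing x L_i, the base
    point of G/K can be sent to x S in G/S, with S = L_i cap x^-1 K x; this map
    relates the value of a module at G/K to the value at L_i/S of its
    restriction to L_i, where the corresponding summand of the induced module
    takes its value. *)
Section OrbitToSummand.
Local Open Scope group_scope.

Lemma orbit_to_summand_subproof X (t : cover_idx Y (push pi X)) s :
  s \in orbit_stab X ->
  (ind_rep (projT2 t))^-1 * s * ind_rep (projT2 t) \in
    orbit_stab (push (iota (projT1 t)) (ind_orbit t)).
Proof.
case: t => i phi /= sX.
have [l lE] : exists l, iota i l = (ind_rep phi)^-1 * s * ind_rep phi.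
  apply/iotaP; rewrite !gmulfM gmulfV !ind_repE; apply: hom_elt_stab.
  exact: mem_push.
rewrite -lE; apply/image_subgP; exists l => //.
change (ind_rep phi * iota i l * (ind_rep phi)^-1 \in orbit_stab X); rewrite lE.
by rewrite !mulgA mulgV mul1g mulgK.
Qed.

Definition orbit_to_summand X (t : cover_idx Y (push pi X)) :
    orbit_hom X (push (iota (projT1 t)) (ind_orbit t)) :=
  orbit_mk (@orbit_to_summand_subproof X t).

Lemma orbit_to_summandE X (t : cover_idx Y (push pi X)) g :
  orbit_to_summand t (orbit_pt _ g) = orbit_pt _ (g * ind_rep (projT2 t)).
Proof. exact: orbit_mkE. Qed.

Lemma orbit_to_summand_nat X Z (f : orbit_hom X Z)
    (t : cover_idx Y (push pi Z)) :
  orbit_comp (push_hom (iota _) (ind_hom f t))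
    (orbit_to_summand (ind_act f t)) =
  orbit_comp (orbit_to_summand t) f.
Proof.
apply: orbit_hom_ext;
  rewrite !orbit_compE orbit_to_summandE mul1g [f _]orbit_funE mul1g
  orbit_to_summandE.
have [l lE] := ind_hom_elt f t.
have lE' : ind_hom f t (orbit_pt _ 1) = orbit_pt _ l.
  by apply: ind_homE lE; rewrite orbit_funE mul1g.
apply: etrans (orbit_fun_pt _ (push_homE (iota _) lE')) _.
by rewrite lE /= !mulgA mulgV mul1g.
Qed.

End OrbitToSummand.

(** The unit of the adjunction: for S in L_i, it sends the value at L_i/S of
    P_i into the value at G/S of the induced module, as the summand at the base
    point of G/L_i. *)
Section Unit.
Local Open Scope group_scope.
Variable i : I.

Lemma unit_idx_subproof (S : orbit (L i)) s :
  s \in orbit_stab (push pi (push (iota i) S)) -> 1^-1 * s * 1 \in orbit_stab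
    (Y i).
Proof.
rewrite invg1 mul1g mulg1 => /image_subgP[_ /image_subgP[l _ <-] <-].
by apply/iotaP; exists l.
Qed.

(** The index at G/S given by the base point of Q/F_i. *)
Definition unit_idx (S : orbit (L i)) : orbit_hom (push pi (push (iota i) S))
    (Y i) :=
  orbit_mk (@unit_idx_subproof S).

Lemma unit_idxE S g : unit_idx S (orbit_pt _ g) = orbit_pt (Y i) g.
Proof. by rewrite [LHS]orbit_mkE mulg1. Qed.

(** The representative attached to [unit_idx S] lies in L_i, but need not be 1.
    *)
Lemma unit_rep (S : orbit (L i)) : exists l, iota i l = ind_rep (unit_idx S).
Proof.
apply/iotaP; rewrite -[pi _]mul1g -[X in X * _]invg1; apply/orbit_pt_eq.
by rewrite -[ind_rep _]mul1g -ind_rep_pt gmulf1 unit_idxE.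
Qed.

Definition unit_elt S : L i := sval (cid (unit_rep S)).
Lemma unit_eltE S : iota i (unit_elt S) = ind_rep (unit_idx S).
Proof. exact: svalP (cid (unit_rep S)). Qed.

Lemma unit_orbit_subproof (S : orbit (L i)) s :
  s \in orbit_stab (ind_orbit (existT _ i (unit_idx S))) ->
  (unit_elt S)^-1^-1 * s * (unit_elt S)^-1 \in orbit_stab S.
Proof.
rewrite mem_conj invgK /= -unit_eltE -gmulfV -!gmulfM.
by move=> /image_subgP[l lS /iota_inj <-].
Qed.

Definition unit_orbit S : orbit_hom (ind_orbit (existT _ i (unit_idx S))) S :=
  orbit_mk (@unit_orbit_subproof S).

Lemma unit_orbitE S l :
  unit_orbit S (orbit_pt _ l) = orbit_pt S (l * (unit_elt S)^-1).
Proof. exact: orbit_mkE. Qed.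

Variable P : forall i, orbit_mod (L i).

Definition unit_fun (S : orbit (L i)) :
    {additive P i S -> mod_pull (iota i) (ind P) S} :=
  ind_in P (unit_idx S) \o mod_map (P i) (unit_orbit S).

Lemma unit_nat S T (f : orbit_hom S T) (p : P i T) :
  unit_fun S (mod_map (P i) f p) = mod_map (mod_pull (iota i) (ind P)) f
    (unit_fun T p).
Proof.
rewrite [RHS]ind_map_in /unit_fun /= -!mod_map_comp.
have e : unit_idx S = orbit_comp (unit_idx T)
  (push_hom pi (push_hom (iota i) f)).
  apply: orbit_hom_ext.
  have fE : f (orbit_pt S 1) = orbit_pt T
    (hom_elt f) by rewrite orbit_funE mul1g.
  rewrite unit_idxE orbit_compE
    (push_homE pi (push_homE (iota i) fE)) unit_idxE.
  apply/orbit_pt_eq; rewrite invg1 mul1g; apply/iotaP; by exists (hom_elt f).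
apply: ind_in_eq => //.
rewrite !orbit_compE unit_orbitE mul1g [LHS]orbit_funE.
pose l := (unit_elt S)^-1 * hom_elt f * unit_elt T.
have lE : ind_hom (push_hom (iota i) f) (existT _ i (unit_idx T))
  (orbit_pt _ 1) =
    orbit_pt _ l.
  apply: (@ind_homE _ _ _ _ (iota i (hom_elt f))).
    by apply: push_homE; rewrite orbit_funE mul1g.
  by rewrite !gmulfM gmulfV !unit_eltE /= -e.
apply: etrans (esym (congr1 (unit_orbit T) lE)).
by rewrite unit_orbitE mulgK.
Qed.

Definition unit_hom : mod_hom (P i) (mod_pull (iota i) (ind P)) :=
  @ModHom (L i) (P i) (mod_pull (iota i) (ind P)) unit_fun unit_nat.

(** Every generator of the induced module is the restriction of a value of the
    unit. *)
Lemma ind_in_unit X (phi : orbit_hom (push pi X) (Y i)) p :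
  mod_map (ind P) (orbit_to_summand (existT _ i phi)) (unit_hom _ p) =
    ind_in P phi p.
Proof.
have e : orbit_comp (unit_idx (ind_orbit (existT _ i phi)))
  (push_hom pi (orbit_to_summand (existT _ i phi))) = phi.
  apply: orbit_hom_ext; rewrite orbit_compE.
  rewrite (push_homE pi (orbit_to_summandE (existT _ i phi) 1)) unit_idxE.
  by rewrite -ind_rep_pt gmulf1.
rewrite [LHS]ind_map_in -mod_map_comp -[in RHS](mod_map_id p).
apply: ind_in_eq => //.
set S := ind_orbit (existT _ i phi).
have lE : ind_hom (orbit_to_summand (existT _ i phi)) (existT _ i (unit_idx S))
  (orbit_pt _ 1) =
    orbit_pt _ (unit_elt S).
  apply: (ind_homE (orbit_to_summandE _ _)).
  by rewrite unit_eltE /= e mul1g mulVg mul1g.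
apply: etrans (congr1 (unit_orbit S) lE) _.
by rewrite unit_orbitE mulgV.
Qed.

End Unit.

Section Adjoint.
Variables (P : forall i, orbit_mod (L i)) (A : orbit_mod G).
Variable k : forall i, mod_hom (P i) (mod_pull (iota i) A).

(** The adjoint of a family of maps from the P_i to the restrictions of [A]. *)
Definition adj_fun X : {additive ind P X -> A X} :=
  dsum_out (I := classical_choiceType (cover_idx Y (push pi X)))
    (fun t => mod_map A (orbit_to_summand t) \o k _
      (ind_orbit t) : {additive _ -> _}).

Lemma adj_fun_in X i (phi : orbit_hom (push pi X) (Y i)) p :
  adj_fun X (ind_in P phi p) = mod_map A (orbit_to_summand (existT _ i phi))
    (k i _ p).
Proof. exact: dsum_out_in. Qed.

Lemma adj_nat X Z (f : orbit_hom X Z) (a : ind P Z) :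
  adj_fun X (mod_map (ind P) f a) = mod_map A f (adj_fun Z a).
Proof.
apply: (@ind_ext _ _ _ (adj_fun X \o mod_map (ind P) f)
  (mod_map A f \o adj_fun Z)).
move=> i phi p; rewrite [LHS](congr1 (adj_fun X) (ind_map_in f p)) adj_fun_in.
rewrite [RHS](congr1 (mod_map A f) (adj_fun_in p)) mod_fun_nat.
rewrite -[RHS]mod_map_comp -(orbit_to_summand_nat f (existT _ i phi)).
by rewrite [RHS]mod_map_comp.
Qed.

Definition adj_hom : mod_hom (ind P) A := ModHom adj_nat.
End Adjoint.

Lemma ind_projective (P : forall i, orbit_mod (L i)) :
  (forall i, mod_projective (P i)) -> mod_projective (ind P).
Proof.
move=> P_proj A B p h p_epi.
have kP i := cid (P_proj i _ _ (mod_pull_hom (iota i) p)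
   (mod_comp (mod_pull_hom (iota i) h) (unit_hom i P)) (fun X => p_epi _)).
exists (adj_hom (fun i => sval (kP i))) => X x.
apply: (@ind_ext _ _ _ (p X \o adj_fun (fun i => sval (kP i)) X) (h X)) =>
  i phi y.
rewrite [LHS](congr1 (p X) (adj_fun_in _ y)) mod_fun_nat.
rewrite (svalP (kP i)) -ind_in_unit [RHS]mod_fun_nat.
by [].
Qed.

Lemma ind_resolution (M : forall i, orbit_mod (L i)) n :
  (forall i, has_proj_resolution (M i) n) -> has_proj_resolution (ind M) n.
Proof.
move=> /dep_choice[P] /dep_choice[D] /dep_choice[e] res.
exists (fun k => ind (fun i => P i k)), (fun k => ind_mor (fun i => D i k)),
  (ind_mor e).
split.
- by move=> k; apply: ind_projective => i; have [+ _ _ _ _] := res i; exact.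
- by move=> k nk; apply: ind_zero => i; have [_ + _ _ _] := res i; exact.
- by apply: ind_mor_epi => i; have [_ _ + _ _] := res i.
- by apply: ind_mor_exact => i; have [_ _ _ + _] := res i.
- by move=> k; apply: ind_mor_exact => i; have [_ _ _ _] := res i; exact.
Qed.

End Induction.

(** * The bound on the Bredon dimension of an extension *)

Lemma bredon_cd_le (G : groupType) (n : nat) :
  (bredon_cd G <= (Posz n)%:E)%E <-> has_proj_resolution (const_Z G) n.
Proof.
rewrite /bredon_cd /proj_dim; case: pselect => [e|ne]; last first.
  by split=> // res; case: ne; exists n; apply/asboolP.
case: ex_minnP => m /asboolP[P [D [e0 [P_proj P0 e_epi De DD]]]] m_min.
rewrite lee_fin lez_nat; split=> [mn|res]; last exact/m_min/asboolP.
exists P, D, e0; split=> // k nk; apply: P0; exact: leq_ltn_trans nk.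
Qed.

Section PullProjective.
Variables (G Q : groupType) (pi : UMagmaMorphism.type G Q).
Hypothesis pi_surj : forall q, exists g, pi g = q.
Variable d : nat.
Hypothesis preim_res : forall F : groupClosed Q, finite_subg F ->
  has_proj_resolution (const_Z (subg (preim_subg pi F))) d.
Variable R : orbit_mod Q.
Hypothesis R_proj : mod_projective R.

Let Y := @mod_elt_orbit Q R.
Let S i : groupClosed G := preim_subg pi (orbit_stab (Y i)).
Let L i : groupType := subg (S i).
Let iota i : UMagmaMorphism.type (L i) G := (val : subg (S i) -> G).

Let iota_inj i : injective (iota i). Proof. exact: val_inj. Qed.

Let iotaP i g : pi g \in orbit_stab (Y i) <-> exists l, iota i l = g.
Proof.
split=> [gY|[l <-]]; last exact: valP l.
by have gS : g \in S i := gY; exists (Subg gS).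
Qed.

Let indM := @ind G Q pi pi_surj _ Y L iota iota_inj iotaP.

(** The module induced from the constant modules is resolved by the modules
    induced from projective resolutions of these. *)
Lemma pd_le_ind_const : pd_le d (indM (fun i => const_Z (L i))).
Proof.
apply/pd_le_of_resolution/ind_resolution => i.
exact: preim_res (orbit_finite (Y i)).
Qed.

(** Being projective, [R] is a retract of the free module on its elements,
    whose pullback along [pi] is by definition the module induced from the
    constant modules. *)
Lemma pull_cover_retract :
  mod_retract (mod_pull pi R) (indM (fun i => const_Z (L i))).
Proof.
have [s sP] := R_proj (mod_id R) (@cover_hom_epi _ R).
pose to := @ModHom G (mod_pull pi (free_cover R))
  (indM (fun i => const_Z (L i)))
  (fun=> idfun) (fun _ _ _ _ => erefl).
pose from := @ModHom G (indM (fun i => const_Z (L i)))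
  (mod_pull pi (free_cover R))
  (fun=> idfun) (fun _ _ _ _ => erefl).
exists (mod_comp to (mod_pull_hom pi s)),
  (mod_comp (mod_pull_hom pi (cover_hom R)) from).
by move=> X m; exact: sP.
Qed.

Lemma pd_le_pull_projective : pd_le d (mod_pull pi R).
Proof. exact: pd_le_retract pull_cover_retract pd_le_ind_const. Qed.

End PullProjective.

Theorem corollary4p5 (H G Q : groupType)
    (iota : UMagmaMorphism.type H G) (pi : UMagmaMorphism.type G Q)
    (iota_inj : injective iota)
    (pi_surj : forall q : Q, exists g : G, pi g = q)
    (iota_pi_exact : forall g : G, pi g = 1%g <-> exists h : H, iota h = g)
    (d : nat)
    (cd_preim_le : forall F : groupClosed Q, finite_subg F ->
       (bredon_cd (subg (preim_subg pi F)) <= (Posz d)%:E)%E) :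
  (bredon_cd G <= (Posz d)%:E + bredon_cd Q)%E.
Proof.
have res F Ffin := (bredon_cd_le _ _).1 (cd_preim_le F Ffin).
case cdQ : (bredon_cd Q) => [n| |]; last by move: cdQ;
  rewrite /bredon_cd /proj_dim; case: pselect.
- have [m nm] : exists m : nat, n = m.
    by move: cdQ; rewrite /bredon_cd /proj_dim; case: pselect => // e [<-];
      exists (ex_minn e).
  rewrite {n}nm in cdQ *.
  have : (bredon_cd Q <= (Posz m)%:E)%E by rewrite cdQ.
  move=> /bredon_cd_le[P [D [e [P_proj P0 e_epi De DD]]]].
  rewrite -EFinD -PoszD; apply/bredon_cd_le/resolution_of_pd_le.
(* The target [const_Z G] is the pullback of [const_Z Q], up to proofs. *)
  pose e' := @ModHom G (mod_pull pi (P 0)) (const_Z G) (fun X => e (push pi X))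
    (fun X Z h x => mod_fun_nat e (push_hom pi h) x).
  apply: (@pd_le_resolution _ d m (fun k => mod_pull pi (P k))
    (fun k => mod_pull_hom pi (D k)) _ e').
  + by move=> k; exact: pd_le_pull_projective.
  + by move=> k mk X; exact: P0.
  + by move=> X; exact: e_epi.
  + by move=> X; exact: De.
  + by move=> k X; exact: DD.
- by rewrite addey // leey.
Qed.
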